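(* Let $\Omega\subset S^n$ be a nonempty open convex set of diameter $<\pi/2$, let $\mathcal{P}$ be the set of all supporting hyperplanes of $\Omega$, and let $F$ be the spherical Funk metric of $\Omega$. Then for all $x,y\in\Omega$, $$F(x,y)=\sup_{\pi\in\mathcal{P}}\log\frac{\sin d(x,\pi)}{\sin d(y,\pi)}.$$
   Context: $S^n$ is the unit sphere (curvature $+1$) and $d$ is its angular distance; $d(x,\pi)$ is the distance from $x$ to the set $\pi$. A hyperplane in $S^n$ is a complete totally geodesic codimension-one subspace (a great sphere); an open half-space is a connected component of the complement of a hyperplane. A subset of $S^n$ is convex if it is contained in an open half-space and every pair of its points can be connected by a geodesic contained in it. A supporting hyperplane of $\Omega$ is a hyperplane that contains a boundary point of $\Omega$ and such that $\Omega$ is contained in one of the two open half-spaces it bounds. For distinct $x,y\in\Omega$, $b(x,y)$ is the first intersection point of $\partial\Omega$ with the geodesic ray $\{\exp_x(t\xi_{xy}):t>0\}$ from $x$ through $y$, where $\xi_{xy}$ is the unit tangent vector at $x$ pointing toward $y$. The spherical Funk metric of $\Omega$ is $$F(x,y)=\log\frac{\sin d(x,b(x,y))}{\sin d(y,b(x,y))}\ \text{ for } x\neq y,\qquad F(x,x)=0.$$ *)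

(* Defs.v *)
(* Real analysis over an abstract R : realType (MathComp-Analysis).
   S^n is the set of unit vectors of R^{n+1}; points and subsets of S^n are row
   vectors 'rV[R]_n.+1 and sets of row vectors included in [sphere R n]. *)
From HB Require Import structures.
From mathcomp Require Import all_boot all_order all_algebra.
From mathcomp Require Import all_classical all_reals all_analysis.

Set Implicit Arguments.
Unset Strict Implicit.
Unset Printing Implicit Defensive.

Import Order.TTheory GRing.Theory Num.Theory.
Import numFieldNormedType.Exports.

Local Open Scope classical_set_scope.
Local Open Scope ring_scope.

Section SphericalFunk.
Variables (R : realType) (n : nat).
Local Notation V := 'rV[R]_n.+1.

Definition dot (u v : V) : R := \sum_i u ord0 i * v ord0 i.

Definition sphere : set V := [set x | dot x x = 1].

Definition dist (x y : V) : R := acos (dot x y).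

(* Meant for nonempty [A] only: the infimum of the empty set is junk. *)
Definition dist_set (x : V) (A : set V) : R := inf [set dist x z | z in A].

(* Meant for nonempty [A] included in the sphere. *)
Definition diam (A : set V) : R := sup [set dist x y | x in A & y in A].

(* Topological notions on S^n use the library's relative topology
   [subspace sphere], where points outside the sphere are isolated. *)
Definition open_in_sphere (A : set V) : Prop :=
  A `<=` sphere /\ open (A : set (subspace sphere)).

Definition sphere_boundary (A : set V) : set V :=
  closure (A : set (subspace sphere)) `\` interior (A : set (subspace sphere)).

Definition unit_tangent (x xi : V) : Prop := dot x xi = 0 /\ dot xi xi = 1.

(* exp_x (t xi) on the unit sphere, for xi a unit tangent vector at x. *)
Definition geodesic (x xi : V) (t : R) : V := cos t *: x + sin t *: xi.

(* The normalized projection of y to the tangent space of the sphere at x;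
   meaningful for y <> x and y <> - x. *)
Definition direction (x y : V) : V :=
  (sin (dist x y))^-1 *: (y - cos (dist x y) *: x).

Definition hyperplane (pi : set V) : Prop :=
  exists u : V, u != 0 /\ pi = [set x | sphere x /\ dot u x = 0].

Definition half_space_of (pi H : set V) : Prop :=
  exists2 x, (sphere `\` pi) x & H = connected_component (sphere `\` pi) x.

Definition open_half_space (H : set V) : Prop :=
  exists2 pi, hyperplane pi & half_space_of pi H.

Definition sphere_convex (A : set V) : Prop :=
  (exists2 H, open_half_space H & A `<=` H) /\
  (forall x y, A x -> A y ->
    exists (xi : V) (l : R), [/\ unit_tangent x xi, 0 <= l, geodesic x xi l = y &
      forall t : R, 0 <= t <= l -> A (geodesic x xi t)]).

Definition supporting_hyperplane (Omega pi : set V) : Prop :=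
  [/\ hyperplane pi,
      exists p, sphere_boundary Omega p /\ pi p &
      exists2 H, half_space_of pi H & Omega `<=` H].

Definition first_boundary_point (Omega : set V) (x y p : V) : Prop :=
  exists t : R, [/\ 0 < t, p = geodesic x (direction x y) t,
    sphere_boundary Omega p &
    forall s : R, 0 < s < t ->
      ~ sphere_boundary Omega (geodesic x (direction x y) s)].

(* The point b(x,y); such a point is unique if it exists, and 0 is a dummy
   value that is not on the sphere. *)
Definition ray_boundary_point (Omega : set V) (x y : V) : V :=
  xget 0 (first_boundary_point Omega x y).

Definition spherical_funk (Omega : set V) (x y : V) : R :=
  if x == y then 0 else
  let b := ray_boundary_point Omega x y in
  ln (sin (dist x b) / sin (dist y b)).

End SphericalFunk.

Arguments sphere : clear implicits.

(* Main.v *)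
Require Import Defs.
From HB Require Import structures.
From mathcomp Require Import all_boot all_order all_algebra.
From mathcomp Require Import all_classical all_reals all_analysis.
From mathcomp Require Import ring lra.

Set Implicit Arguments.
Unset Strict Implicit.
Unset Printing Implicit Defensive.

Import Order.TTheory GRing.Theory Num.Theory.
Import numFieldNormedType.Exports.

Local Open Scope classical_set_scope.
Local Open Scope ring_scope.

(** Let [b] be the point where the geodesic ray from [x] through [y] leaves
    [Omega], at time [t], and let [l] be the distance from [x] to [y].  In the
    ambient Euclidean space the three points satisfy the linear relation
      [sin t *: y = sin (t - l) *: x + sin l *: b]    ([geodesic_chord]),
    and the sine of the distance from [z] to the hyperplane orthogonal to [u]
    is [`|dot u z| / sqrt (dot u u)] ([sin_dist_hyperplane]).  A supporting
    hyperplane has a normal [u] that is positive on [Omega]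
    ([supporting_normal]), hence nonnegative at [b]
    ([boundary_dot_ge0]).  Pairing the relation with [u] gives
      [dot u x / dot u y <= sin t / sin (t - l)],
    whose right-hand side is the exponential of the Funk distance
    ([spherical_funk_ray]), with equality when the hyperplane passes through
    [b].  So the supremum is at most the Funk distance, and it is
    attained as soon as there is a supporting hyperplane through [b].

    To find one, consider the convex cone spanned by [Omega].  All its points
    are internal because [Omega] is open, and [b] is on its boundary.  The
    gauge of the cone in the direction [x] is a sublinear function, negative
    on the cone and vanishing at [b]; by the Hahn-Banach theorem
    ([hahn_banach]) some linear functional below the gauge agrees with it at
    [b], and its opposite is the required normal
    ([cone_supporting_functional], [exit_supporting_functional]).

    The diameter bound is what keeps all distances below [pi / 2]: it makes
    the connecting geodesics minimal ([convex_geodesic]) and forces every ray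
    to leave [Omega] before time [pi / 2] ([geodesic_exit]). *)

(** * Euclidean inner product and distance to a hyperplane *)

Section Dot.
Variables (R : realType) (n : nat).
Local Notation V := 'rV[R]_n.+1.
Implicit Types (u v w x y z : V) (a b t : R).

Lemma dotC u v : dot u v = dot v u.
Proof. by apply: eq_bigr => i _; rewrite mulrC. Qed.

Lemma dotDl u v w : dot (u + v) w = dot u w + dot v w.
Proof. by rewrite -big_split; apply: eq_bigr => i _; rewrite mxE mulrDl. Qed.

Lemma dotZl a u v : dot (a *: u) v = a * dot u v.
Proof.
by rewrite /dot big_distrr; apply: eq_bigr => i _; rewrite mxE -mulrA.
Qed.

Lemma dotNl u v : dot (- u) v = - dot u v.
Proof. by rewrite -scaleN1r dotZl mulN1r. Qed.

Lemma dot0l u : dot 0 u = 0.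
Proof. by apply: big1 => i _; rewrite mxE mul0r. Qed.

Lemma dotDr u v w : dot u (v + w) = dot u v + dot u w.
Proof. by rewrite !(dotC u) dotDl. Qed.

Lemma dotZr a u v : dot u (a *: v) = a * dot u v.
Proof. by rewrite !(dotC u) dotZl. Qed.

Lemma dotNr u v : dot u (- v) = - dot u v.
Proof. by rewrite !(dotC u) dotNl. Qed.

Definition dotE := (dotDl, dotDr, dotNl, dotNr, dotZl, dotZr).

Lemma dot_ge0 u : 0 <= dot u u.
Proof. by apply: sumr_ge0 => i _; rewrite -expr2 sqr_ge0. Qed.

Lemma dot_eq0 u : (dot u u == 0) = (u == 0).
Proof.
rewrite psumr_eq0 => [|i _]; last by rewrite -expr2 sqr_ge0.
apply/allP/eqP => [u0|-> i _]; last by rewrite /= mxE mulr0 eqxx.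
apply/rowP => i; rewrite mxE; apply/eqP.
by have := u0 i (mem_index_enum i); rewrite /= mulf_eq0 orbb.
Qed.

Lemma dot_gt0 u : (0 < dot u u) = (u != 0).
Proof. by rewrite lt0r dot_ge0 andbT dot_eq0. Qed.

Lemma normalize_sphere u : u != 0 -> sphere R n ((Num.sqrt (dot u u))^-1 *: u).
Proof.
rewrite -dot_gt0 => u0; rewrite /sphere /= !dotE mulrA -expr2 exprVn.
by rewrite sqr_sqrtr ?ltW// mulVf ?gt_eqF.
Qed.

Lemma dot_sphere_bound x y : sphere R n x -> sphere R n y -> -1 <= dot x y <= 1.
Proof.
rewrite /sphere /= => xx yy.
have := dot_ge0 (x - y); have := dot_ge0 (x + y).
rewrite !dotE (dotC y x) xx yy => ? ?; apply/andP; split; lra.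
Qed.

(** Bessel's inequality for two orthonormal vectors. *)
Lemma bessel2 u z x : sphere R n u -> sphere R n z -> dot u z = 0 ->
  dot u x ^+ 2 + dot z x ^+ 2 <= dot x x.
Proof.
rewrite /sphere /= => uu zz uz.
have := dot_ge0 (x - dot u x *: u - dot z x *: z).
rewrite !dotE (dotC z u) (dotC x u) (dotC x z) uu zz uz; nra.
Qed.

Lemma cos_dist x y : sphere R n x -> sphere R n y -> cos (dist x y) = dot x y.
Proof. by move=> sx sy; rewrite acosK// in_itv/=; exact: dot_sphere_bound. Qed.

Lemma dist_itv x y : sphere R n x -> sphere R n y -> 0 <= dist x y <= pi.
Proof.
move=> sx sy; have d := dot_sphere_bound sx sy.
by rewrite acos_ge0 ?acos_lepi.
Qed.

(** In dimension at least two no vector spans the whole space. *)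
Lemma exists_orthogonal u : (0 < n)%N -> exists2 z, sphere R n z & dot u z = 0.
Proof.
move=> n0.
suff [v v0 uv] : exists2 v, v != 0 & dot u v = 0.
  exists ((Num.sqrt (dot v v))^-1 *: v); first exact: normalize_sphere.
  by rewrite dotZr uv mulr0.
have dotd (i : 'I_n.+1) : dot u (delta_mx 0 i) = u 0 i.
  rewrite /dot (bigD1 i)//= mxE !eqxx mulr1 big1 ?addr0// => j ji.
  by rewrite mxE (negbTE ji) andbF mulr0.
have i01 : (ord_max : 'I_n.+1) != ord0 by rewrite -val_eqE /= -lt0n.
have [u0|u0] := eqVneq (u 0 0) 0.
  exists (delta_mx 0 0); last by rewrite dotd.
  apply/eqP => /rowP/(_ 0)/eqP; rewrite !mxE !eqxx /=; exact/negP/oner_neq0.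
(* The quarter turn of the first and last coordinates of [u]. *)
exists (u 0 ord_max *: delta_mx 0 0 - u 0 0 *: delta_mx 0 ord_max).
  apply/eqP => /rowP/(_ ord_max)/eqP; rewrite !mxE !eqxx (negbTE i01) /=.
  by rewrite mulr0 mulr1 sub0r oppr_eq0; exact/negP.
by rewrite !dotE !dotd; ring.
Qed.

(** The distance is realised by the normalised projection of [x] to the
    hyperplane, which makes the angle with cosine [sqrt (1 - a ^+ 2)] for
    [a] the sine of the angle between [x] and the hyperplane; when [x] is a
    pole of the hyperplane that projection vanishes, and every point of the
    hyperplane is at distance [pi / 2]. *)
Lemma sin_dist_hyperplane u x : (0 < n)%N -> u != 0 -> sphere R n x ->
  sin (dist_set x [set z | sphere R n z /\ dot u z = 0]) =
  `|dot u x| / Num.sqrt (dot u u).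
Proof.
move=> n0 u0 sx; set P := [set z | _].
have nu0 : 0 < Num.sqrt (dot u u) by rewrite sqrtr_gt0 dot_gt0.
set w : V := (Num.sqrt (dot u u))^-1 *: u.
have sw : sphere R n w := normalize_sphere u0.
have uw : u = Num.sqrt (dot u u) *: w by rewrite scalerA divff ?scale1r// gt_eqF.
have Pw z : P z <-> sphere R n z /\ dot w z = 0.
  split=> -[sz uz]; split=> //; first by rewrite dotZl uz mulr0.
  by rewrite uw dotZl uz mulr0.
have -> : `|dot u x| / Num.sqrt (dot u u) = `|dot w x|.
  by rewrite dotZl normrM ger0_norm ?invr_ge0 ?ltW// mulrC.
clearbody w; set a := dot w x; set s := Num.sqrt (1 - a ^+ 2).
have a1 : a ^+ 2 <= 1.
  by have /andP[] := dot_sphere_bound sw sx; rewrite -/a => ? ?; nra.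
have s1 : -1 <= s <= 1.
  rewrite (le_trans _ (sqrtr_ge0 _)) ?lerN10//=.
  by rewrite -[leRHS]sqrtr1 ler_wsqrtr// gerBl sqr_ge0.
have ub z : P z -> dot x z <= s.
  move=> /Pw[sz wz]; apply: le_trans (ler_norm _) _.
  rewrite -sqrtr_sqr ler_wsqrtr// lerBrDr addrC dotC.
  by rewrite -[leRHS]sx; exact: bessel2.
have [z Pz xz] : exists2 z, P z & dot x z = s.
  (* [x - a *: w] is the projection of [x]; it vanishes when [x] is a pole. *)
  have [p0|p0] := eqVneq (x - a *: w) 0.
    have [z sz wz] := exists_orthogonal w n0.
    exists z; first exact/Pw.
    have xE : x = a *: w by apply/eqP; rewrite -subr_eq0 p0.
    rewrite xE dotZl wz mulr0; apply/esym/eqP; rewrite sqrtr_eq0 subr_le0.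
    by move: sx; rewrite /sphere /= {1 2}xE !dotE sw mulr1 -expr2 => ->.
  exists ((Num.sqrt (dot (x - a *: w) (x - a *: w)))^-1 *: (x - a *: w)).
    apply/Pw; split; first exact: normalize_sphere.
    by rewrite !dotE sw -/a mulr1 subrr mulr0.
  have pp : dot (x - a *: w) (x - a *: w) = 1 - a ^+ 2.
    by rewrite !dotE sw sx (dotC x w) -/a; ring.
  rewrite pp -/s.
  have s0 : s != 0.
    by rewrite sqrtr_eq0 -ltNge -pp dot_gt0.
  rewrite !dotE sx (dotC x w) -/a -expr2.
  have <- : s ^+ 2 = 1 - a ^+ 2 by rewrite sqr_sqrtr// subr_ge0.
  by rewrite expr2 mulKf.
have -> : dist_set x P = acos s.
  have lb : lbound [set dist x z | z in P] (acos s).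
    move=> _ [t Pt <-].
    have [st _] := Pt; have st1 := dot_sphere_bound sx st.
    rewrite -xz leNgt; apply/negP; rewrite -/(dist x z).
    have [sz _] := Pz.
    rewrite -ltr_cos ?in_itv/= ?dist_itv//.
    by rewrite !cos_dist// xz ltNge ub.
  apply/eqP; rewrite eq_le; apply/andP; split.
    apply: ge_inf; first by exists (acos s).
    by exists z => //; rewrite /dist xz.
  by apply: lb_le_inf lb; exists (dist x z), z.
by rewrite sin_acos// sqr_sqrtr ?subr_ge0// opprB addrC subrK sqrtr_sqr.
Qed.

End Dot.

(** * Hahn-Banach theorem and supporting functionals of convex cones *)

Section HahnBanach.
Variables (R : realType) (n : nat).
Local Notation V := 'rV[R]_n.+1.
Implicit Types (q : V -> R) (b u v w x y z : V) (a t : R).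

Definition sublinear q :=
  (forall v w, q (v + w) <= q v + q w) /\
  (forall a v, 0 < a -> q (a *: v) <= a * q v).

Lemma sublinearZ q a v : sublinear q -> 0 < a -> q (a *: v) = a * q v.
Proof.
move=> [_ qZ] a0; apply/eqP; rewrite eq_le qZ//=.
rewrite mulrC -ler_pdivlMr// mulrC.
have := qZ a^-1 (a *: v); rewrite scalerA mulVf ?gt_eqF// scale1r.
by apply; rewrite invr_gt0.
Qed.

Lemma sublinear0 q : sublinear q -> q 0 = 0.
Proof.
move=> sq; have := sublinearZ 0 sq (ltr0n _ 2); rewrite scaler0; lra.
Qed.

Lemma sublinear_subN q v : sublinear q -> 0 <= q v + q (- v).
Proof. by move=> sq; rewrite -(sublinear0 sq) -(subrr v); exact: sq.1. Qed.

(** Lowering [q] as far as possible in the direction [w] makes it additive on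
    the line spanned by [w] without losing sublinearity. *)
Lemma sublinear_flatten q w : sublinear q ->
  exists q', [/\ sublinear q', forall v, q' v <= q v & q' (- w) <= - q w].
Proof.
move=> sq.
(* [E v] is bounded below by [- q (- v)], and [s = 1] at [v = - w] gives the
   last claim. *)
pose E v := [set q (v + s *: w) - s * q w | s in [set s | 0 <= s]].
have qZ0 s : 0 <= s -> q (s *: w) = s * q w.
  rewrite le_eqVlt => /orP[/eqP<-|s0]; last exact: sublinearZ.
  by rewrite scale0r sublinear0// mul0r.
have Elb v : lbound (E v) (- q (- v)).
  move=> _ [s s0 <-]; rewrite lerBrDr addrC -lerBrDr opprK -qZ0//.
  have := sq.1 (v + s *: w) (- v).
  by rewrite addrAC subrr add0r.
have hE v : has_lbound (E v) by exists (- q (- v)).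
have E0 v : E v !=set0 by exists (q (v + 0 *: w) - 0 * q w), 0 => /=.
have le v s : 0 <= s -> inf (E v) <= q (v + s *: w) - s * q w.
  by move=> s0; apply: ge_inf (hE v) _ _; exists s.
exists (fun v => inf (E v)); split.
- split=> [v1 v2|a v a0] /=.
    rewrite -lerBlDr; apply: (lb_le_inf (E0 v1)) => _ [s1 s10 <-].
    rewrite lerBlDr [leRHS]addrC -lerBlDr;
    apply: (lb_le_inf (E0 v2)) => _ [s2 s20 <-].
    rewrite lerBlDr; apply: le_trans (le _ (s1 + s2) (addr_ge0 s10 s20)) _.
    have -> : v1 + v2 + (s1 + s2) *: w = (v1 + s1 *: w) + (v2 + s2 *: w).
      by rewrite scalerDl addrACA.
    have := sq.1 (v1 + s1 *: w) (v2 + s2 *: w); lra.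
  rewrite mulrC -ler_pdivrMr//; apply: (lb_le_inf (E0 v)) => _ [s s0 <-].
  rewrite ler_pdivrMr//; apply: le_trans (le _ (a * s) (mulr_ge0 (ltW a0) s0)) _.
  have -> : a *: v + (a * s) *: w = a *: (v + s *: w) by rewrite scalerDr scalerA.
  have := sq.2 a (v + s *: w) a0; lra.
- by move=> v; have := le v 0 (lexx _); rewrite scale0r addr0 mul0r subr0.
- by have := le (- w) 1 ler01; rewrite scale1r addNr sublinear0// mul1r sub0r.
Qed.

(** Flattening along one vector keeps the oddness obtained along the previous
    ones: [q' v + q' (- v)] is always nonnegative, so it stays zero when [q']
    is lowered. *)
Lemma sublinear_flatten_seq q (s : seq V) : sublinear q ->
  exists q', [/\ sublinear q', forall v, q' v <= q v &
    {in s, forall w, q' (- w) = - q' w}].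
Proof.
move=> sq; elim: s => [|w s [q1 [sq1 q1q q1s]]]; first by exists q.
have [q2 [sq2 q2q1 q2w]] := sublinear_flatten w sq1.
exists q2; split=> // [v|z]; first exact: le_trans (q2q1 v) (q1q v).
have odd v : q2 (- v) <= - q2 v -> q2 (- v) = - q2 v.
  by have := sublinear_subN v sq2 => ? ?; apply/eqP; rewrite eq_le; lra.
rewrite inE => /predU1P[->|zs]; apply: odd.
  by apply: le_trans q2w _; rewrite lerN2.
by apply: le_trans (q2q1 _) _; rewrite (q1s z zs) lerN2.
Qed.

(** Hahn-Banach in finite dimension: flattening [q] along [w] and then along
    the canonical basis yields a sublinear function that is odd on a basis,
    hence linear.  Flattening along [w] first forces the value [q w] at [w],
    since no later step can raise the value at [- w] above [- q w]. *)
Lemma hahn_banach q w : sublinear q ->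
  exists2 u, (forall v, dot u v <= q v) & dot u w = q w.
Proof.
move=> sq.
have [q1 [sq1 q1q q1w]] := sublinear_flatten w sq.
have [q2 [sq2 q2q1 odd]] :=
  sublinear_flatten_seq [seq delta_mx 0 i | i <- enum 'I_n.+1] sq1.
pose e (i : 'I_n.+1) : V := delta_mx 0 i.
have oddE i : q2 (- e i) = - q2 (e i).
  by apply: odd; apply/mapP; exists i; rewrite ?mem_enum.
have lin a i : q2 (a *: e i) = a * q2 (e i).
  have [a0|a0|->] := ltgtP a 0.
  - by rewrite -[a *: _]opprK -scalerN -scaleNr sublinearZ ?oddE ?oppr_gt0// mulrNN.
  - exact: sublinearZ.
  - by rewrite scale0r mul0r sublinear0.
pose u : V := \row_i q2 (e i).
have ge v : q2 v <= dot u v.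
  rewrite {1}(row_sum_delta v) /dot.
  elim/big_ind2 : _ => [|x1 x2 y1 y2 h1 h2|i _]; first by rewrite sublinear0.
    exact: le_trans (sq2.1 _ _) (lerD h1 h2).
  by rewrite lin mxE mulrC.
have le v : dot u v <= q2 v.
  have := ge (- v); rewrite dotNr; have := sublinear_subN v sq2; lra.
exists u => [v|]; first exact: le_trans (le v) (le_trans (q2q1 v) (q1q v)).
apply/eqP; rewrite eq_le (le_trans (le w) (le_trans (q2q1 w) (q1q w)))//=.
have := le (- w); have := q2q1 (- w); rewrite dotNr; lra.
Qed.

(** The functional comes from the gauge [q v = inf {t | K (v + t *: x)}]:
    [q] is negative on [K] since points of [K] are internal, and [q b = 0]
    since [b] sits on the boundary of [K] in the direction [x]. *)
Lemma cone_supporting_functional (K : set V) x b :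
  (forall v w, K v -> K w -> K (v + w)) ->
  (forall a v, 0 < a -> K v -> K (a *: v)) ->
  (forall k v, K k -> exists2 e, 0 < e & K (k + e *: v)) ->
  K x -> ~ K b -> (forall t, 0 < t -> K (b + t *: x)) ->
  exists2 u, (forall k, K k -> 0 < dot u k) & dot u b = 0.
Proof.
move=> KD KZ Kint Kx Kb Kbt.
(* If [0] were in [K] it would be internal, so [K] would contain [b]. *)
have K0 : ~ K 0.
  move=> K0; have [e e0] := Kint 0 b K0; rewrite add0r => /(KZ e^-1).
  by rewrite scalerA mulVf ?gt_eqF// scale1r invr_gt0 => /(_ e0).
pose E v := [set t | K (v + t *: x)].
have E0 v : E v !=set0.
  have [e e0 Ke] := Kint x v Kx.
  exists e^-1; rewrite /E /= -(@scalerK _ _ e _ v) ?gt_eqF// -scalerDr.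
  by apply: KZ; rewrite ?invr_gt0// addrC.
have Elb v r : K (- v + r *: x) -> lbound (E v) (- r).
  move=> Kr t /= Kt; rewrite leNgt; apply/negP => tr; apply: K0.
  have := KD _ _ Kt Kr; rewrite addrACA subrr add0r -scalerDl => Ktr.
  rewrite -(subrr ((t + r) *: x)) -scaleNr; apply: KD => //; apply: KZ => //.
  by rewrite oppr_gt0 -ltrBrDr sub0r.
have hE v : has_lbound (E v) by have [r /Elb] := E0 (- v); exists (- r).
pose q v := inf (E v).
have sq : sublinear q.
  split=> [v w|a v a0].
    rewrite -lerBlDr; apply: (lb_le_inf (E0 v)) => s Ks.
    rewrite lerBlDr [leRHS]addrC -lerBlDr; apply: (lb_le_inf (E0 w)) => t Kt.
    rewrite lerBlDr; apply: ge_inf => //;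
    rewrite /E /= (addrC t) scalerDl addrACA.
    exact: KD.
  rewrite mulrC -ler_pdivrMr//; apply: (lb_le_inf (E0 v)) => s Ks.
  rewrite ler_pdivrMr//; apply: ge_inf => //.
  by rewrite /E /= mulrC -scalerA -scalerDr; exact: KZ.
have qK k : K k -> q k < 0.
  move=> Kk; have [e e0 Ke] := Kint k (- x) Kk;
  apply: (@le_lt_trans _ _ (- e)); last first.
    by rewrite oppr_lt0.
  by apply: ge_inf => //; rewrite /E /= scaleNr -scalerN.
have qb : q b = 0.
  apply/eqP; rewrite eq_le; apply/andP; split.
    apply/ler_addgt0Pl => e e0; rewrite addr0; apply: ge_inf => //; exact: Kbt.
  apply: (lb_le_inf (E0 b)) => t Kt; rewrite leNgt; apply/negP => t0; apply: Kb.
  rewrite -(addrK (t *: x) b) -scaleNr; apply: KD => //; apply: KZ => //.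
  by rewrite oppr_gt0.
have [u uq ub] := hahn_banach b sq.
exists (- u) => [k Kk|]; last by rewrite dotNl ub qb oppr0.
by rewrite dotNl oppr_gt0; exact: le_lt_trans (uq k) (qK k Kk).
Qed.

End HahnBanach.

(** * Geodesics of the sphere *)

Section Geodesic.
Variables (R : realType) (n : nat).
Local Notation V := 'rV[R]_n.+1.
Implicit Types (x xi u : V) (A : set V) (s t : R).

Lemma dot_geodesic x xi s t : sphere R n x -> unit_tangent x xi ->
  dot (geodesic x xi s) (geodesic x xi t) = cos (t - s).
Proof.
rewrite /sphere /= => xx [xxi xixi]; rewrite /geodesic !dotE (dotC xi x) xx xxi xixi.
by rewrite cosB; ring.
Qed.

Lemma geodesic0 x xi : geodesic x xi 0 = x.
Proof. by rewrite /geodesic cos0 sin0 scale1r scale0r addr0. Qed.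

Lemma geodesic_sphere x xi t : sphere R n x -> unit_tangent x xi ->
  sphere R n (geodesic x xi t).
Proof. by move=> sx txi; rewrite /sphere /= dot_geodesic// subrr cos0. Qed.

Lemma dist_geodesic x xi s t : sphere R n x -> unit_tangent x xi ->
  0 <= t - s <= pi -> dist (geodesic x xi s) (geodesic x xi t) = t - s.
Proof. by move=> sx txi ts; rewrite /dist dot_geodesic// cosK// in_itv. Qed.

Lemma dist_geodesic0 x xi t : sphere R n x -> unit_tangent x xi ->
  0 <= t <= pi -> dist x (geodesic x xi t) = t.
Proof.
move=> sx txi t0; have := @dist_geodesic x xi 0 t sx txi.
by rewrite geodesic0 subr0; exact.
Qed.

Lemma continuous_geodesic x xi : continuous (geodesic x xi).
Proof.
by move=> t; apply: cvgD; apply: cvgZr_tmp;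
  [exact: continuous_cos|exact: continuous_sin].
Qed.

Lemma continuous_dot u : continuous (dot u).
Proof.
move=> v; apply: (@cvg_big _ _ +%R 0 xpredT _ _ (nbhs v)) => [|i _].
  exact: add_continuous.
by apply: cvgM; [exact: cvg_cst|exact: coord_continuous].
Qed.

(** The set of distances is bounded by [pi], so the supremum defining [diam]
    is a genuine upper bound. *)
Lemma dist_le_diam A x y : A `<=` sphere R n -> A x -> A y ->
  dist x y <= diam A.
Proof.
move=> sA Ax Ay; apply: ub_le_sup; last by exists x => //; exists y.
exists pi => _ [z Az [w Aw <-]].
by have /andP[] := dist_itv (sA _ Az) (sA _ Aw).
Qed.

Lemma open_in_sphere_not_boundary A x :
  open_in_sphere A -> A x -> ~ sphere_boundary A x.
Proof.
by move=> [_ oA] Ax [_]; apply; move/interior_id: oA => ->.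
Qed.

(** Convexity and small diameter force the connecting geodesic to be the
    minimal one, so it is the one given by [direction]. *)
Lemma convex_geodesic A x y : A `<=` sphere R n -> sphere_convex A ->
  diam A < pi / 2 -> A x -> A y ->
  exists xi, [/\ unit_tangent x xi, geodesic x xi (dist x y) = y,
    0 <= dist x y < pi / 2, forall t, 0 <= t <= dist x y -> A (geodesic x xi t)
    & x != y -> direction x y = xi].
Proof.
move=> sA [_ cA] dA Ax Ay.
have [xi [l [txi l0 yE seg]]] := cA x y Ax Ay.
have sx := sA _ Ax.
have pi0 := pi_gt0 R.
have l2 : l < pi / 2.
  rewrite ltNge; apply/negP => l2.
  have h : 0 <= (pi / 2 : R) <= l by apply/andP; split => //; lra.
  have := dist_le_diam sA Ax (seg _ h).
  rewrite dist_geodesic0//; first by apply/negP; rewrite -ltNge.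
  by apply/andP; split; lra.
have dl : dist x y = l.
  by rewrite -yE dist_geodesic0//; apply/andP; split => //; lra.
exists xi; rewrite dl; split => //; first by rewrite l0.
move=> xy; have lgt0 : 0 < l.
  rewrite lt0r l0 andbT; apply: contra xy => /eqP l00.
  by rewrite -yE l00 geodesic0.
rewrite /direction dl -yE /geodesic addrC addKr scalerA mulVf ?scale1r//.
by rewrite gt_eqF// sin_gt0_pi// lgt0/=; lra.
Qed.

End Geodesic.

(** * Convex subsets of the sphere *)

Section Convex.
Variables (R : realType) (n : nat).
Local Notation V := 'rV[R]_n.+1.
Implicit Types (u v x y z p xi : V) (A P : set V) (r s t : R).

Lemma open_in_sphere_near A (f : R -> V) s :
  open_in_sphere A -> {for s, continuous f} -> A (f s) ->
  \forall t \near s, sphere R n (f t) -> A (f t).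
Proof.
move=> [sA /open_subspaceP[U oU UA]] cf Af.
have Uf : U (f s).
  suff : (U `&` sphere R n) (f s) by case.
  by rewrite UA; split => //; exact: sA.
have : nbhs (f s) U by apply: open_nbhs_nbhs.
move=> /cf nU; near=> t => sft.
have : (U `&` sphere R n) (f t) by split => //; near: t.
by rewrite UA => -[].
Unshelve. all: by end_near. Qed.

(** The exit time is the infimum of the times at which the geodesic is out of
    [A].  It is less than [pi / 2] because the distance to [x] along the
    geodesic is the time, which the diameter bounds as long as the geodesic
    stays in [A]. *)
Lemma geodesic_exit A x xi : open_in_sphere A -> diam A < pi / 2 -> A x ->
  unit_tangent x xi ->
  exists t, [/\ 0 < t < pi / 2, forall s, 0 <= s < t -> A (geodesic x xi s),
    ~ A (geodesic x xi t) & sphere_boundary A (geodesic x xi t)].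
Proof.
move=> oA dA Ax txi; set g := geodesic x xi.
have sA := oA.1; have sx := sA _ Ax; have pi0 := pi_gt0 R.
have sg s : sphere R n (g s) by exact: geodesic_sphere.
have diamg s : 0 <= s <= pi -> A (g s) -> s <= diam A.
  by move=> s0 /(dist_le_diam sA Ax); rewrite dist_geodesic0.
pose E := [set s | 0 <= s /\ ~ A (g s)].
have E0 : E !=set0.
  exists (pi / 2); split; first by lra.
  move=> /diamg h; suff : (pi / 2 : R) <= diam A by apply/negP; rewrite -ltNge.
  by apply: h; apply/andP; split; lra.
have hE : has_lbound E by exists 0 => s [].
set t := inf E.
have t0 : 0 <= t by apply: lb_le_inf E0 _ => s [].
have gA s : 0 <= s < t -> A (g s).
  move=> /andP[s0 st]; apply: contrapT => nA.
  by have := ge_inf hE (conj s0 nA); rewrite leNgt st.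
have nAg : ~ A (g t).
  move=> Ag; have := open_in_sphere_near oA (@continuous_geodesic _ _ x xi t) Ag.
  move=> /nbhs_ballP[e e0 be].
  have [s [s0 ns] se] := inf_adherent e0 (conj E0 hE).
  have ts := ge_inf hE (conj s0 ns); apply: ns; apply: be => //.
  by rewrite /ball /= ler0_norm; rewrite -/t in se ts *; lra.
have tgt0 : 0 < t.
  rewrite lt0r t0 andbT; apply/eqP => t00; apply: nAg.
  by rewrite t00 /g geodesic0.
have t2 : t < pi / 2.
  apply: (le_lt_trans _ dA); rewrite leNgt; apply/negP => dt.
  have d0 : 0 <= diam A by apply: (diamg 0); [lra|apply: gA; rewrite lexx].
  have tpi : t <= pi.
    rewrite leNgt; apply/negP => tpi.
    (* At time [pi] the geodesic would be at distance [pi] from [x]. *)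
    have Api : A (g pi) by apply: gA; rewrite tpi ltW.
    by have := diamg pi; rewrite lexx ltW// => /(_ erefl Api); lra.
  have : (diam A + t) / 2 <= diam A.
    by apply: diamg; [apply/andP; split; lra|apply: gA; apply/andP; split; lra].
  lra.
exists t; split => //; first by rewrite tgt0.
split; last first.
  have [_ /interior_id ->] := oA; exact.
move=> B; rewrite /nbhs /= -nbhs_subspace_in// => nB.
have cg : g s @[s --> t] --> g t by exact: continuous_geodesic.
have nBl : \forall s \near t^'-, sphere R n (g s) -> B (g s).
  have nb : \forall s \near t, sphere R n (g s) -> B (g s) := cg _ nB.
  by rewrite /at_left near_withinE; apply: filterS nb => s + _.
have h1 : \forall s \near t^'-, 0 < s by apply: nbhs_left_gt.
have h2 : \forall s \near t^'-, s < t by apply: nbhs_left_lt.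
have [s [[sB s0] st]] := @filter_ex _ t^'- _ _ (filterI (filterI nBl h1) h2).
by exists (g s); split; [apply: gA; rewrite ltW|exact: sB].
Qed.

Definition cone A : set V := [set v | exists r z, [/\ 0 < r, A z & v = r *: z]].

Lemma cone_subset A z : A z -> cone A z.
Proof. by exists 1, z; rewrite scale1r. Qed.

Lemma cone_scale A r v : 0 < r -> cone A v -> cone A (r *: v).
Proof.
move=> r0 [s [z [s0 Az ->]]]; exists (r * s), z.
by rewrite mulr_gt0// scalerA.
Qed.

(** The normalisation of [z + s *: v] is a continuous curve in the sphere that
    starts at [z], so it stays in the open set [A] for small [s]. *)
Lemma cone_internal A k v : open_in_sphere A -> cone A k ->
  exists2 e, 0 < e & cone A (k + e *: v).
Proof.
move=> oA [r [z [r0 Az ->]]].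
suff [e e0 [s [w [s0 Aw we]]]] : exists2 e, 0 < e & cone A (z + e *: v).
  exists (r * e); first exact: mulr_gt0.
  by rewrite -scalerA -scalerDr; apply: cone_scale => //; exists s, w.
have sz := oA.1 _ Az.
pose h s := z + s *: v.
have ch : {for 0, continuous h}.
  by apply: cvgD; [exact: cvg_cst|apply: cvgZr_tmp; exact: cvg_id].
have h0 : h 0 = z by rewrite /h scale0r addr0.
pose N s := Num.sqrt (dot (h s) (h s)).
have N0 : N 0 = 1 by rewrite /N h0 sz sqrtr1.
have cN : {for 0, continuous N}.
  apply: (@continuous_comp _ _ _ (fun s => dot (h s) (h s)) Num.sqrt); last first.
    exact: sqrt_continuous.
  apply: (@cvg_big _ _ +%R 0 xpredT _ _ (nbhs (0 : R))) => [|i _].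
    exact: add_continuous.
  have chi : {for 0, continuous (fun s => h s ord0 i)}.
    exact: (@continuous_comp _ _ _ h (fun w : V => w ord0 i) _ ch
      (@coord_continuous _ _ _ _ _ _)).
  exact: cvgM.
have Ngt0 : \forall s \near (0 : R), 0 < N s.
  by apply: (cvgr_gt (N 0) cN); rewrite N0 ltr01.
have cf : {for 0, continuous (fun s => (N s)^-1 *: h s)}.
  by apply: cvgZ => //; apply: cvgV => //; rewrite N0 oner_neq0.
have := open_in_sphere_near oA cf; rewrite N0 h0 invr1 scale1r => /(_ Az) Anear.
have [e [e0 [Ne Ae]]] : exists e, 0 < e /\ (0 < N e /\
    (sphere R n ((N e)^-1 *: h e) -> A ((N e)^-1 *: h e))).
  have /nbhs_ballP[e e0 be] : \forall s \near (0 : R), 0 < N s /\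
      (sphere R n ((N s)^-1 *: h s) -> A ((N s)^-1 *: h s)) by exact: filterI.
  exists (e / 2); split; first by rewrite divr_gt0.
  by apply: be; rewrite /ball /= sub0r normrN gtr0_norm ?divr_gt0//
    ltr_pdivrMr// ltr_pMr// ltr1n.
exists e => //; exists (N e), ((N e)^-1 *: h e); split => //.
  apply: Ae; apply: normalize_sphere; rewrite -dot_gt0.
  by rewrite -sqrtr_gt0.
by rewrite scalerA divff ?scale1r// gt_eqF.
Qed.

(** The sum of two vectors lies on the ray through a point of the geodesic
    segment joining their directions; that point is found by the intermediate
    value theorem. *)
Lemma cone_add A v w : A `<=` sphere R n -> sphere_convex A ->
  diam A < pi / 2 -> cone A v -> cone A w -> cone A (v + w).
Proof.
move=> sA cA dA [a [x [a0 Ax ->]]] [b [y [b0 Ay ->]]].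
have [xi [txi yE d2 seg _]] := convex_geodesic sA cA dA Ax Ay.
move: d2 yE seg; set l := dist x y => /andP[l0 l2] yE seg.
have pi0 := pi_gt0 R.
have cl : 0 < cos l by apply: cos_gt0_pihalf; apply/andP; split; lra.
have sl : 0 <= sin l by apply: sin_ge0_pi; apply/andP; split; lra.
pose c := a + b * cos l; pose d := b * sin l.
have c0 : 0 < c by rewrite addr_gt0// mulr_gt0.
have d0 : 0 <= d by rewrite mulr_ge0// ltW.
have [t] : exists2 t, t \in `[0, l] & c * sin t - d * cos t = 0.
  apply: IVT => //.
    apply: continuous_subspaceT => t; apply: cvgB.
      by apply: cvgM; [exact: cvg_cst|exact: continuous_sin].
    by apply: cvgM; [exact: cvg_cst|exact: continuous_cos].
  rewrite sin0 cos0 ge_min le_max mulr0 mulr1 sub0r oppr_le0 d0/=.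
  by apply/orP; right; rewrite /c /d; have := mulr_ge0 (ltW a0) sl; lra.
rewrite in_itv/= => /andP[t0 tl] ct.
have cost : 0 < cos t by apply: cos_gt0_pihalf; apply/andP; split; lra.
have st : 0 <= sin t by apply: sin_ge0_pi; apply/andP; split; lra.
pose r := c * cos t + d * sin t.
have cs := cos2Dsin2 t.
have r0 : 0 < r.
  by apply: ltr_wpDr; [exact: mulr_ge0|exact: mulr_gt0].
have rc : r * cos t = c.
  have -> : r * cos t = c * (cos t ^+ 2 + sin t ^+ 2)
                      - sin t * (c * sin t - d * cos t) by rewrite /r; ring.
  by rewrite cs ct; ring.
have rs : r * sin t = d.
  have -> : r * sin t = d * (cos t ^+ 2 + sin t ^+ 2)
                      + cos t * (c * sin t - d * cos t) by rewrite /r; ring.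
  by rewrite cs ct; ring.
exists r, (geodesic x xi t); split => //; first by apply: seg; rewrite t0.
rewrite /geodesic scalerDr !scalerA rc rs -yE /geodesic scalerDr !scalerA.
by rewrite addrA -scalerDl.
Qed.

(** On a component of the complement of the hyperplane the functional [dot u]
    does not vanish, so by connectedness it has a constant sign. *)
Lemma supporting_normal A P : supporting_hyperplane A P ->
  exists u, [/\ u != 0, P = [set z | sphere R n z /\ dot u z = 0] &
    forall z, A z -> 0 < dot u z].
Proof.
move=> [[u [u0 ->]] _ [_ [x0 [sx0 ux0] ->]] AH].
set P0 := [set z | _] in ux0 AH *.
set C := connected_component _ _ in AH *.
have conn : is_interval [set dot u z | z in C].
  apply/connected_intervalP/connected_continuous_connected.
    exact: component_connected.
  exact/continuous_subspaceT/continuous_dot.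
have CP z : C z -> dot u z != 0.
  by move=> /connected_component_sub[sz nP]; apply/eqP => uz; apply: nP.
have Cx0 : C x0 by exact: connected_component_refl.
have same z w : C z -> C w -> dot u z < 0 -> 0 < dot u w -> False.
  move=> Cz Cw z0 w0; have [] := conn (dot u z) (dot u w) _ _ 0.
  - by exists z.
  - by exists w.
  - by rewrite !ltW.
  by move=> k /CP/eqP.
have [x0neg|x0pos|/eqP] := ltgtP (dot u x0) 0; last by rewrite (negbTE (CP _ Cx0)).
  exists (- u); split; first by rewrite oppr_eq0.
    by apply/seteqP; split => z [sz uz]; split => //;
      [rewrite dotNl uz oppr0|apply: oppr_inj; rewrite -dotNl uz oppr0].
  move=> z /AH Cz; rewrite dotNl oppr_gt0.
  have := CP _ Cz; rewrite neq_lt => /orP[//|z0].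
  by case: (same _ _ Cx0 Cz x0neg z0).
exists u; split => // z /AH Cz.
have := CP _ Cz; rewrite neq_lt => /orP[z0|//].
by case: (same _ _ Cz Cx0 z0 x0pos).
Qed.

(** Geodesics of [A] are connected and avoid the hyperplane, so they keep [A]
    in a single component of its complement. *)
Lemma normal_supporting A u x p : A `<=` sphere R n -> sphere_convex A ->
  A x -> (forall z, A z -> 0 < dot u z) -> sphere R n p ->
  sphere_boundary A p -> dot u p = 0 ->
  supporting_hyperplane A [set z | sphere R n z /\ dot u z = 0].
Proof.
move=> sA [_ cA] Ax uA sp bp up; set P := [set z | _].
have AP : A `<=` sphere R n `\` P.
  move=> z Az; split; first exact: sA.
  by move=> [_ uz]; have := uA z Az; rewrite uz ltxx.
split.
- exists u; split => //; apply/eqP => u0.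
  by have := uA x Ax; rewrite u0 dot0l ltxx.
- by exists p.
- exists (connected_component (sphere R n `\` P) x).
    by exists x => //; exact: AP.
  move=> z Az; have [xi [l [txi l0 zE seg]]] := cA x z Ax Az.
  have gx : [set geodesic x xi t | t in `[0, l]] x.
    by exists 0; [rewrite /= in_itv/= lexx|exact: geodesic0].
  apply: (connected_component_max gx).
  - by move=> _ [t /= tl <-]; apply/AP/seg; move: tl; rewrite in_itv.
  - apply: connected_continuous_connected; first exact: segment_connected.
    exact/continuous_subspaceT/continuous_geodesic.
  - by exists l => //; rewrite /= in_itv/= l0 lexx.
Qed.

End Convex.

(** * The Funk metric along a ray *)

Section Funk.
Variables (R : realType) (n : nat).
Local Notation V := 'rV[R]_n.+1.
Implicit Types (u v x y z p xi : V) (A P : set V) (r s t l : R).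

(** Three points of a great circle are linearly dependent; the coefficients
    are the sines of the opposite arcs. *)
Lemma geodesic_chord x xi s t :
  sin t *: geodesic x xi s = sin (t - s) *: x + sin s *: geodesic x xi t.
Proof.
rewrite /geodesic !scalerDr !scalerA addrA -scalerDl sinB (mulrC (sin t) (sin s)).
by congr (_ *: _ + _); ring.
Qed.

(** The exit point lies on the boundary of the cone over [A] in the direction
    [x]: for [s > 0] the vector [b + s *: x] is on the ray through an earlier
    point [geodesic x xi t'] of the geodesic, where [t'] solves
    [sin (t - t') = s * sin t']. *)
Lemma exit_supporting_functional A x xi t : open_in_sphere A ->
  sphere_convex A -> diam A < pi / 2 -> A x -> unit_tangent x xi ->
  0 < t < pi / 2 -> (forall s, 0 <= s < t -> A (geodesic x xi s)) ->
  ~ A (geodesic x xi t) ->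
  exists2 u, (forall z, A z -> 0 < dot u z) & dot u (geodesic x xi t) = 0.
Proof.
move=> oA cA dA Ax txi /andP[t0 t2] gA nAt; set b := geodesic x xi t.
have sA := oA.1; have sx := sA _ Ax; have pi0 := pi_gt0 R.
have st0 : 0 < sin t by apply: sin_gt0_pi; apply/andP; split; lra.
have [||||||u uA ub] := @cone_supporting_functional _ _ (cone A) x b.
- by move=> v w; exact: cone_add.
- by move=> a v; exact: cone_scale.
- by move=> k v; exact: cone_internal.
- exact: cone_subset.
- move=> [r [z [r0 Az bE]]]; apply: nAt; rewrite -/b bE.
  have : dot b b = 1 by exact: geodesic_sphere.
  rewrite bE !dotE (sA _ Az) mulr1 -expr2 => /eqP.
  rewrite -[X in _ == X](expr1n _ 2) eqrXn2 ?ltW// => /eqP ->.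
  by rewrite scale1r.
- move=> s s0.
  have [t'] : exists2 t', t' \in `[0, t] & sin (t - t') - s * sin t' = 0.
    apply: IVT; first exact: ltW.
      apply: continuous_subspaceT => t'; apply: cvgB.
        apply: (@continuous_comp _ _ _ (fun a => t - a) sin); last first.
          exact: continuous_sin.
        by apply: cvgB; [exact: cvg_cst|exact: cvg_id].
      by apply: cvgM; [exact: cvg_cst|exact: continuous_sin].
    rewrite subr0 subrr sin0 mulr0 subr0 sub0r ge_min le_max (ltW st0)/=.
    by rewrite andbT; apply/orP; right; rewrite oppr_le0 mulr_ge0// ltW.
  rewrite in_itv/= => /andP[t'0 t't] /eqP; rewrite subr_eq0 => /eqP ht'.
  have t'gt0 : 0 < t'.
    rewrite lt0r t'0 andbT; apply/eqP => t'E; move: ht'.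
    by rewrite t'E subr0 sin0 mulr0 => stE; rewrite stE ltxx in st0.
  have t'lt : t' < t.
    rewrite lt_neqAle t't andbT; apply/eqP => t'E; move: ht'.
    rewrite t'E subrr sin0 => /esym/eqP.
    by rewrite mulf_eq0 (gt_eqF s0) (gt_eqF st0).
  have st'0 : 0 < sin t' by apply: sin_gt0_pi; apply/andP; split; lra.
  exists (sin t / sin t'), (geodesic x xi t'); split.
  + exact: divr_gt0.
  + by apply: gA; rewrite t'0.
  + rewrite mulrC -scalerA geodesic_chord ht' scalerDr !scalerA.
    by rewrite (mulrC s) mulKf ?mulVf ?gt_eqF// scale1r addrC.
by exists u => // z Az; apply: uA; exact: cone_subset.
Qed.

(** Were [dot u p] negative, it would be so on a neighbourhood of [p], which
    meets [A]. *)
Lemma boundary_dot_ge0 A u p : sphere R n p -> sphere_boundary A p ->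
  (forall z, A z -> 0 < dot u z) -> 0 <= dot u p.
Proof.
move=> sp [clp _] uA; rewrite leNgt; apply/negP => up.
have nB : nbhs (p : subspace (sphere R n)) [set q | dot u q < 0].
  rewrite /nbhs /= -nbhs_subspace_in//.
  have : \forall q \near p, dot u q < 0.
    exact: (cvgr_lt (dot u p) (@continuous_dot _ _ u p)).
  by rewrite /within; apply: filterS => q + _.
by have [z [Az /= uz]] := clp _ nB; have := lt_trans (uA z Az) uz; rewrite ltxx.
Qed.

(** The case [x = y] is covered by [l = 0] and an arbitrary ray from [x]. *)
Lemma spherical_funk_ray A x y : (0 < n)%N -> open_in_sphere A ->
  sphere_convex A -> diam A < pi / 2 -> A x -> A y ->
  exists xi t l, [/\ unit_tangent x xi, 0 <= l < t, t < pi / 2 &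
    geodesic x xi l = y] /\
    [/\ forall s, 0 <= s < t -> A (geodesic x xi s), ~ A (geodesic x xi t),
      sphere_boundary A (geodesic x xi t) &
      spherical_funk A x y = ln (sin t / sin (t - l))].
Proof.
move=> n0 oA cA dA Ax Ay; have sA := oA.1; have sx := sA _ Ax.
have pi0 := pi_gt0 R.
have [<-|xy] := eqVneq x y.
  have [xi sxi xxi] := exists_orthogonal x n0.
  have txi : unit_tangent x xi by [].
  have [t [/andP[t0 t2] gA nAt bt]] := geodesic_exit oA dA Ax txi.
  exists xi, t, 0; split; first by split => //; [rewrite lexx|exact: geodesic0].
  split => //; rewrite /spherical_funk eqxx subr0 divff ?ln1// gt_eqF//.
  by apply: sin_gt0_pi; apply/andP; split; lra.
have [xi [txi yE /andP[l0 l2] seg /(_ xy) dE]] := convex_geodesic sA cA dA Ax Ay.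
have [t [/andP[t0 t2] gA nAt bt]] := geodesic_exit oA dA Ax txi.
have lt : dist x y < t.
  rewrite ltNge; apply/negP => tl; apply: nAt; apply: seg.
  by rewrite ltW.
exists xi, t, (dist x y); split; first by rewrite l0.
split => //; rewrite /spherical_funk (negbTE xy).
have -> : ray_boundary_point A x y = geodesic x xi t.
  have : first_boundary_point A x y (ray_boundary_point A x y).
    apply: xgetPex; exists (geodesic x xi t), t; rewrite dE; split => //.
    move=> s /andP[s0 st]; apply: open_in_sphere_not_boundary => //.
    by apply: gA; rewrite ltW.
  rewrite /first_boundary_point dE => -[t' [t'0 -> bt' nb]].
  have [tt'|tt'|->//] := ltgtP t' t.
    case: (@open_in_sphere_not_boundary _ _ A (geodesic x xi t')) => //.
    by apply: gA; rewrite ltW.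
  by case: (nb t) => //; rewrite t0.
congr (ln (sin _ / sin _)).
  by rewrite dist_geodesic0//; apply/andP; split; lra.
by rewrite -{1}yE dist_geodesic//; apply/andP; split; lra.
Qed.

End Funk.

Theorem theorem3p12 (R : realType) (n : nat) (hn : (0 < n)%N)
    (Omega : set 'rV[R]_n.+1)
    (Omega_neq0 : Omega !=set0)
    (Omega_open : open_in_sphere Omega)
    (Omega_convex : sphere_convex Omega)
    (Omega_diam : diam Omega < pi / 2)
    (x y : 'rV[R]_n.+1) (hx : Omega x) (hy : Omega y) :
  (spherical_funk Omega x y)%:E =
  ereal_sup [set (ln (sin (dist_set x P) / sin (dist_set y P)))%:E
            | P in [set P | supporting_hyperplane Omega P]].
Proof.
have sO := Omega_open.1.
have pi0 := pi_gt0 R.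
have [xi [t [l [[txi /andP[l0 lt] t2 yE] [gO nOt bt ->]]]]] :=
  spherical_funk_ray hn Omega_open Omega_convex Omega_diam hx hy.
have sx := sO _ hx; have sy := sO _ hy.
set b := geodesic x xi t in nOt bt.
have sb : sphere R n b by exact: geodesic_sphere.
have st0 : 0 < sin t by apply: sin_gt0_pi; apply/andP; split; lra.
have stl0 : 0 < sin (t - l) by apply: sin_gt0_pi; apply/andP; split; lra.
have sl0 : 0 <= sin l by apply: sin_ge0_pi; apply/andP; split; lra.
have chord u : sin t * dot u y = sin (t - l) * dot u x + sin l * dot u b.
  by rewrite -!dotZr -dotDr -geodesic_chord yE.
have ratio u (P := [set z | sphere R n z /\ dot u z = 0]) : u != 0 ->
    (forall z, Omega z -> 0 < dot u z) ->
    sin (dist_set x P) / sin (dist_set y P) = dot u x / dot u y.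
  move=> u0 uO; have ux := uO _ hx; have uy := uO _ hy.
  rewrite !sin_dist_hyperplane// !gtr0_norm// invfM invrK mulrACA mulVf ?mulr1//.
  by rewrite gt_eqF// sqrtr_gt0 dot_gt0.
apply/eqP; rewrite eq_le; apply/andP; split.
  have [u uO] := exit_supporting_functional Omega_open Omega_convex
    Omega_diam hx txi (introT andP (conj (le_lt_trans l0 lt) t2)) gO nOt.
  rewrite -/b => ub.
  have hP := normal_supporting sO Omega_convex hx uO sb bt ub.
  have u0 : u != 0.
    by apply/eqP => u0; have := uO _ hx; rewrite u0 dot0l ltxx.
  apply: ereal_sup_ubound; exists [set z | sphere R n z /\ dot u z = 0] => //.
  rewrite ratio//; congr (ln _)%:E; apply/eqP.
  have [uy0 stl] : dot u y != 0 /\ sin (t - l) != 0.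
    by rewrite !lt0r_neq0 ?uO.
  by rewrite eqr_div// chord ub mulr0 addr0 mulrC.
apply: ge_ereal_sup => _ [P hP <-].
have [u [u0 -> uO]] := supporting_normal hP.
have ux := uO _ hx; have uy := uO _ hy.
rewrite ratio// lee_fin ler_ln ?posrE ?divr_gt0//.
rewrite ler_pdivrMr// mulrAC ler_pdivlMr// chord mulrC lerDl.
by rewrite mulr_ge0// (boundary_dot_ge0 sb bt uO).
Qed.
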